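(* Let $D=(V,E)$ be a directed graph with $n=|V|$ vertices, and let $s,t\in V$. Suppose $A$ and $B$ are $st$-embracing spanning trees of $D$. Then there exist $st$-embracing spanning trees $A=T_0,T_1,\dots,T_{q-1},T_q=B$ of $D$ with $q\le n-1$ such that $|T_{i-1}\triangle T_i|=2$ and $|T_i\cap B|\ge |T_{i-1}\cap B|$ for all $i\in\{1,\dots,q\}$.
   Context: A spanning tree of a directed graph $D=(V,E)$ is a subset $T\subseteq E$ of arcs whose underlying undirected graph is a spanning tree on $V$. For $u,v\in V$ and a spanning tree $T$, $T[u,v]$ denotes the unique path in the underlying tree from $u$ to $v$, with arcs keeping their orientation from $D$ (so it need not be a directed path). A spanning tree $T$ is called $st$-embracing if $T[s,t]$ is a directed path from $s$ to $t$, i.e., a sequence of arcs $v_0v_1, v_1v_2,\dots,v_{k-1}v_k$ of $D$ with $v_0=s$, $v_k=t$ and all $v_i$ distinct (this definition applies whether or not $st$ is itself an arc of $D$). *)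

(* Defs.v *)
From mathcomp Require Import all_boot.

Set Implicit Arguments.
Unset Strict Implicit.
Unset Printing Implicit Defensive.

(* A finite directed graph.  Arcs are abstract objects with a tail and a head,
   so that antiparallel arcs stay distinct in the underlying undirected graph;
   parallel arcs and loops are allowed.  The digraphs with E \subset V x V are
   those in which an arc is determined by its tail and head. *)
Record digraph := Digraph {
  vertex : finType;
  darc : finType;
  dtail : darc -> vertex;
  dhead : darc -> vertex }.

(* One step of a walk in the underlying undirected graph: (e, true) follows e
   from its tail to its head, (e, false) follows e against its orientation. *)
Definition step (D : digraph) : Type := (darc D * bool)%type.

Definition step_src (D : digraph) (x : step D) : vertex D :=
  if x.2 then dtail x.1 else dhead x.1.

Definition step_tgt (D : digraph) (x : step D) : vertex D :=
  if x.2 then dhead x.1 else dtail x.1.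

Fixpoint is_walk (D : digraph) (u v : vertex D) (p : seq (step D)) : bool :=
  if p is x :: p' then (step_src x == u) && is_walk (step_tgt x) v p'
  else u == v.

Definition uses_only (D : digraph) (T : {set darc D}) (p : seq (step D)) :
    bool :=
  all (fun x => x.1 \in T) p.

Definition is_path (D : digraph) (T : {set darc D}) (u v : vertex D)
    (p : seq (step D)) : bool :=
  [&& is_walk u v p, uses_only T p & uniq (u :: [seq step_tgt x | x <- p])].

(* Requiring the arcs to be distinct excludes going back and forth along a
   single arc, whereas a loop, or two parallel or antiparallel arcs, do form
   a cycle. *)
Definition is_cycle (D : digraph) (T : {set darc D}) (u : vertex D)
    (p : seq (step D)) : bool :=
  [&& p != [::], is_walk u u p, uses_only T p,
      uniq [seq step_tgt x | x <- p] & uniq [seq x.1 | x <- p]].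

Definition tconnected (D : digraph) (T : {set darc D}) : Prop :=
  forall u v : vertex D, exists p : seq (step D), is_path T u v p.

Definition tacyclic (D : digraph) (T : {set darc D}) : Prop :=
  forall (u : vertex D) (p : seq (step D)), ~~ is_cycle T u p.

Definition spanning_tree (D : digraph) (T : {set darc D}) : Prop :=
  tconnected T /\ tacyclic T.

Definition directed (D : digraph) (p : seq (step D)) : bool :=
  all (fun x => x.2) p.

(* In a spanning tree T the path p below is unique: it is T[s,t]. *)
Definition embracing_tree (D : digraph) (s t : vertex D) (T : {set darc D}) :
    Prop :=
  spanning_tree T /\
  exists p : seq (step D), is_path T s t p /\ directed p.

Definition symdiff (X : finType) (S T : {set X}) : {set X} :=
  (S :\: T) :|: (T :\: S).

(* Main.v *)
(** Process the arcs of [B] one at a time, adding each missing arc [b] to the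
    current tree [T] and removing an arc [f] of the cycle that it closes.  First
    come the arcs of [B[s,t]], from [t] backwards: for [b = uv], [f] is the first
    arc of [T[u,v]], which is not on the part of [B[s,t]] already present, since
    that part avoids [u].  If [f] lies on [T[s,t]], then [f] leaves [u] (otherwise
    [u] and [v] would both be joined to [t] without [f]), so [T[s,u]], [b] and
    [B[v,t]] lead from [s] to [t].  Once [B[s,t]] is present, [f] can be any arc
    of the cycle outside [B].  Every arc of [B] costs at most one exchange, and
    exchanges that add an arc of [B] cannot decrease the intersection with [B]. *)

Require Import Defs.
From mathcomp Require Import all_boot.

Set Implicit Arguments.
Unset Strict Implicit.
Unset Printing Implicit Defensive.

Section Digraph.
Variable D : digraph.
Implicit Types (A B T X Y W : {set darc D}) (d : pred (step D)).
Implicit Types (u v w : vertex D) (e f : darc D) (p : seq (step D)).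

(** * Reachability through a set of arcs *)

Definition adj d T : rel (vertex D) := fun u v =>
  [exists x : darc D * bool,
    [&& x.1 \in T, d x, step_src x == u & step_tgt x == v]].

(** The predicate [d] selects the admissible steps: [predT] gives connection in the underlying
    undirected graph, [x.2] gives directed reachability. *)
Definition joins d T : rel (vertex D) := connect (adj d T).

Notation ujoins := (joins predT).
Notation djoins := (joins (fun x => x.2)).

Lemma adjP d T u v :
  reflect (exists x : step D, [/\ x.1 \in T, d x, step_src x = u & step_tgt x = v])
          (adj d T u v).
Proof.
apply: (iffP existsP) => [[x /and4P[xT dx /eqP su /eqP tv]] | [x [xT dx su tv]]].
  by exists x.
by exists x; rewrite xT dx su tv !eqxx.
Qed.

Lemma joins_sub d d' T X : T \subset X -> subpred d d' ->
  subrel (joins d T) (joins d' X).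
Proof.
move=> /subsetP sTX sdd'; apply: connect_sub => u v /adjP[x [xT dx su tv]].
by apply/connect1/adjP; exists x; split=> //; [apply: sTX | apply: sdd'].
Qed.

Lemma ujoinsS T X : T \subset X -> subrel (ujoins T) (ujoins X).
Proof. by move=> sTX; apply: joins_sub. Qed.

Lemma djoinsS T X : T \subset X -> subrel (djoins T) (djoins X).
Proof. by move=> sTX; apply: joins_sub. Qed.

Lemma djoins_ujoins T : subrel (djoins T) (ujoins T).
Proof. exact: joins_sub. Qed.

Lemma joins_trans d T v u w : joins d T u v -> joins d T v w -> joins d T u w.
Proof. exact: connect_trans. Qed.

Lemma joins_refl d T : reflexive (joins d T).
Proof. exact: connect0. Qed.

Lemma ujoins_sym T : symmetric (ujoins T).
Proof.
suffices adjT u v: adj predT T u v -> adj predT T v u.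
  by apply: sym_connect_sym => u v; apply/idP/idP; apply: adjT.
case/adjP=> -[e b] [/= eT _ su tv]; apply/adjP; exists (e, ~~ b).
by split=> //; rewrite /step_src /step_tgt /= if_neg.
Qed.

Lemma djoins_arc T e : e \in T -> djoins T (dtail e) (dhead e).
Proof. by move=> eT; apply/connect1/adjP; exists (e, true). Qed.

Lemma ujoins_arc T e : e \in T -> ujoins T (dtail e) (dhead e).
Proof. by move=> eT; apply/djoins_ujoins/djoins_arc. Qed.

(** A walk can be shortened until it crosses [e] at most once, in one direction or the other.
    Deleting or adding an arc is analysed through this case split rather than through paths. *)
Lemma ujoins_setU1 e X u v : ujoins (e |: X) u v ->
  [\/ ujoins X u v,
      ujoins X u (dtail e) /\ ujoins X (dhead e) v
    | ujoins X u (dhead e) /\ ujoins X (dtail e) v].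
Proof.
case/connectP=> p; elim: p u => [|w p IHp] u /=.
  by move=> _ ->; constructor 1; apply: joins_refl.
case/andP=> /adjP[x [xX _ su tw]] /IHp{}IHp /IHp{IHp}.
case/setU1P: xX => [xe|xX]; last first.
  have uw: ujoins X u w by apply/connect1/adjP; exists x.
  case=> [wv|[wt hv]|[wh tv]].
  - by constructor 1; apply: joins_trans wv.
  - by constructor 2; split=> //; apply: joins_trans wt.
  - by constructor 3; split=> //; apply: joins_trans wh.
rewrite -{}su -{}tw /step_src /step_tgt {}xe.
by case: ifP => _ [wv|[wt hv]|[wh tv]]; do ?[by constructor 1 |
  by constructor 2; split=> //; apply: joins_refl |
  by constructor 3; split=> //; apply: joins_refl].
Qed.

(** A directed walk crosses [e] only forwards, so the third case disappears. *)
Lemma djoins_setU1 e X u v : djoins (e |: X) u v ->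
  djoins X u v \/ djoins X u (dtail e) /\ djoins X (dhead e) v.
Proof.
case/connectP=> p; elim: p u => [|w p IHp] u /=.
  by move=> _ ->; left; apply: joins_refl.
case/andP=> /adjP[x [xX dx su tw]] /IHp{}IHp /IHp{IHp}.
case/setU1P: xX => [xe|xX]; last first.
  have uw: djoins X u w by apply/connect1/adjP; exists x.
  case=> [wv|[wt hv]]; first by left; apply: joins_trans wv.
  by right; split=> //; apply: joins_trans wt.
rewrite -{}su -{}tw /step_src /step_tgt dx {}xe.
by case=> [wv|[wt hv]]; right; split=> //; apply: joins_refl.
Qed.

(** * Paths and reachability *)

Lemma is_path_joins d T u v p :
  is_walk u v p -> uses_only T p -> all d p -> joins d T u v.
Proof.
elim: p u => [|x p IHp] u /=; first by move=> /eqP-> _ _; apply: joins_refl.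
case/andP=> /eqP su wp /andP[xT pT] /andP[dx dp].
by apply: joins_trans (IHp _ wp pT dp); apply/connect1/adjP; exists x.
Qed.

Lemma joins_is_path d T u v :
  joins d T u v -> exists2 p, is_path T u v p & all d p.
Proof.
case/connectP=> q0 /shortenP[q adjq Uq _] ->{q0}.
suffices [p [wp pT dp Ep]]: exists p,
    [/\ is_walk u (last u q) p, uses_only T p, all d p & map (@step_tgt D) p = q].
  by exists p => //; rewrite /is_path wp pT Ep.
elim: q u {Uq} adjq => [|w q IHq] u /=; first by exists [::]; rewrite /= eqxx.
case/andP=> /adjP[x [xT dx su tw]] /IHq[p [wp pT dp Ep]].
by exists (x :: p); rewrite /= xT dx su tw eqxx Ep.
Qed.

(** A later step on the arc of [x] would end at one of the two ends of [x], both of which the path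
    has already visited. *)
Lemma is_path_uniq_arcs T u v p : is_path T u v p -> uniq [seq x.1 | x <- p].
Proof.
elim: p u => [|x p IHp] u //= /and3P[/andP[/eqP su wp] /andP[_ pT] /= /andP[up Up]].
have /IHp->: is_path T (step_tgt x) v p by apply/and3P.
rewrite andbT; apply/mapP=> -[y yp xy].
have yt: step_tgt y \in [seq step_tgt z | z <- p] by apply: map_f.
have: step_tgt y \in [:: step_src x; step_tgt x].
  by rewrite /step_src /step_tgt xy !inE; do 2 case: ifP => _; rewrite eqxx ?orbT.
rewrite !inE su; move: up Up; rewrite inE negb_or => /andP[_ up] /andP[tp _].
by case/orP=> /eqP yE; rewrite yE ?(negPf up) ?(negPf tp) in yt.
Qed.

(** * Trees in terms of reachability *)

Definition acyclic T :=
  [forall e in T, ~~ ujoins (T :\ e) (dtail e) (dhead e)].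

Definition tree T := [forall u, forall v, ujoins T u v] && acyclic T.

(** Being acyclic means that every arc is a bridge: the rest of a cycle bypasses its first arc, and
    a path bypassing an arc closes a cycle with it. *)
Lemma acyclicP T : reflect (tacyclic T) (acyclic T).
Proof.
apply: (iffP forall_inP) => acT.
  move=> u [|x p]; rewrite /is_cycle //=.
  apply/negP=> /and4P[/andP[/eqP su wp] /andP[xT pT] _ /andP[xp _]].
  have /acT: x.1 \in T by [].
  have: ujoins (T :\ x.1) (step_tgt x) u.
    apply: is_path_joins wp _ (all_predT _); apply/allP=> y yp.
    rewrite !inE (allP pT) // andbT.
    by apply: contraNneq xp => <-; apply: map_f.
  rewrite -su /step_src /step_tgt; case: ifP => _ xj; last by rewrite xj.
  by rewrite ujoins_sym xj.
move=> e eT; apply/negP; rewrite ujoins_sym.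
case/joins_is_path=> p pP _; case/negP: (acT (dtail e) ((e, true) :: p)).
have Up := is_path_uniq_arcs pP; case/and3P: pP => wp pT Vp.
rewrite /is_cycle /= eqxx wp eT Up; move: Vp => /= ->.
rewrite andbT /=; apply/andP; split.
  by apply: sub_all pT => y /setD1P[].
by apply/mapP=> -[y /(allP pT) + ye]; rewrite -ye !inE eqxx.
Qed.

Lemma treeP T : reflect (spanning_tree T) (tree T).
Proof.
apply: (iffP andP) => -[cT /acyclicP acT]; split=> //.
  by move=> u v; have /joins_is_path[p] := forallP (forallP cT u) v; exists p.
apply/forallP=> u; apply/forallP=> v; have [p /and3P[wp pT _]] := cT u v.
exact: is_path_joins wp pT (all_predT _).
Qed.

Definition embracing s t T := tree T && djoins T s t.

Lemma embracingP s t T : reflect (embracing_tree s t T) (embracing s t T).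
Proof.
apply: (iffP andP) => [[/treeP tT /joins_is_path[p pP dp]]|[/treeP tT [p [pP dp]]]].
  by split=> //; exists p.
by split=> //; case/and3P: pP => wp pT _; apply: is_path_joins wp pT dp.
Qed.

(** * Exchanging and counting the arcs of a tree *)

Lemma acyclic_arc T e :
  acyclic T -> e \in T -> ~~ ujoins (T :\ e) (dtail e) (dhead e).
Proof. by move/forall_inP; apply. Qed.

Lemma tree_ujoins T u v : tree T -> ujoins T u v.
Proof. by case/andP=> /forallP/(_ u)/forallP/(_ v). Qed.

Lemma tree_subset_eq T X : tree T -> tree X -> X \subset T -> X = T.
Proof.
move=> /andP[_ acT] tX sXT; apply/eqP; rewrite eqEsubset sXT.
apply/subsetP=> e eT; apply: contraNT (acyclic_arc acT eT) => eX.
by apply: ujoinsS (tree_ujoins _ _ tX); rewrite subsetD1 sXT.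
Qed.

(** Take a minimal [Y] between [X] and [T] that joins [u] to [v], and [f] in [Y] outside [X]. If
    [T :\ f] still joined [u] to [v], it would also join the ends of [f], since [u] and [v] reach
    them inside [Y :\ f]. *)
Lemma separating_arc T X u v : acyclic T -> X \subset T ->
    ujoins T u v -> ~~ ujoins X u v ->
  exists2 f, f \in T :\: X & ~~ ujoins (T :\ f) u v.
Proof.
move=> acT sXT Tuv Xuv.
pose P Y := (X \subset Y) && ujoins Y u v.
have [|Y /minsetP[/andP[sXY Yuv] minY] sYT] := @minset_exists _ P T.
  by rewrite /P sXT.
have /properP[_ [f fY fX]]: X \proper Y.
  by rewrite properEneq sXY andbT; apply: contraNneq Xuv => ->.
have fT := subsetP sYT f fY; exists f; first by rewrite inE fX.
have Yfuv: ~~ ujoins (Y :\ f) u v.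
  apply/negP=> Yfuv; have /setP/(_ f) : Y :\ f = Y.
    by apply: minY (subD1set _ _); rewrite /P subsetD1 sXY fX.
  by rewrite !inE eqxx fY.
have sYf: subrel (ujoins (Y :\ f)) (ujoins (T :\ f)) by apply/ujoinsS/setSD.
apply: contra (acyclic_arc acT fT) => Tfuv.
rewrite -(setD1K fY) in Yuv; case/ujoins_setU1: Yuv => [|[/sYf + /sYf]|[/sYf + /sYf]].
- by rewrite (negPf Yfuv).
- rewrite ujoins_sym => tu hv; apply: joins_trans tu _.
  by apply: joins_trans Tfuv _; rewrite ujoins_sym.
- move=> uh tv; apply: joins_trans tv _; apply: joins_trans uh.
  by rewrite ujoins_sym.
Qed.

(** In [T] the ends of [b] are connected only through [f], so [b] in turn reconnects the ends of
    [f]. *)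
Lemma tree_exchange T b f : tree T -> f \in T ->
  ~~ ujoins (T :\ f) (dtail b) (dhead b) -> tree (b |: T :\ f).
Proof.
move=> tT fT sep; case/andP: (tT) => _ acT; set T' := b |: _.
have sfT': subrel (ujoins (T :\ f)) (ujoins T') by apply/ujoinsS/subsetUr.
have bT': ujoins T' (dtail b) (dhead b) by apply/ujoins_arc/setU11.
have T'f: ujoins T' (dtail f) (dhead f).
  have := tree_ujoins (dtail b) (dhead b) tT; rewrite -{1}(setD1K fT).
  case/ujoins_setU1=> [|[/sfT' tt /sfT' hh]|[/sfT' th /sfT' thb]].
  - by rewrite (negPf sep).
  - rewrite ujoins_sym in tt; rewrite ujoins_sym in hh.
    exact: joins_trans tt (joins_trans bT' hh).
  - by rewrite ujoins_sym in bT'; apply: joins_trans thb (joins_trans bT' th).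
apply/andP; split.
  apply/forallP=> u; apply/forallP=> v.
  have := tree_ujoins u v tT; rewrite -{1}(setD1K fT).
  case/ujoins_setU1=> [/sfT' //|[/sfT' ut /sfT' hv]|[/sfT' uh /sfT' tv]].
    exact: joins_trans ut (joins_trans T'f hv).
  by rewrite ujoins_sym in T'f; apply: joins_trans uh (joins_trans T'f tv).
apply/forall_inP=> e; case/setU1P=> [->|/setD1P[ef eT]].
  by apply: contra sep; apply: ujoinsS; rewrite subDset.
have eTf: e \in T :\ f by rewrite !inE ef.
(* A bypass of the old arc [e] either avoids [b], against the acyclicity of [T], or crosses [b];
   then its remainder together with [e] joins the ends of [b] in [T :\ f]. *)
apply/negP=> T'e.
have: ujoins (b |: T :\ f :\ e) (dtail e) (dhead e).
  by apply: ujoinsS T'e; rewrite setDUl setSU // subsetDl.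
have sef: subrel (ujoins (T :\ f :\ e)) (ujoins (T :\ f)).
  exact/ujoinsS/subD1set.
case/ujoins_setU1=> [te|[/sef tt /sef hh]|[/sef th /sef tb]].
- case/negP: (acyclic_arc acT eT); apply: ujoinsS te.
  exact/setSD/subD1set.
- case/negP: sep; rewrite ujoins_sym; apply: joins_trans hh _.
  by rewrite ujoins_sym; apply: joins_trans (ujoins_arc eTf); rewrite ujoins_sym.
- case/negP: sep; apply: joins_trans tb _; rewrite ujoins_sym.
  by apply: joins_trans (ujoins_arc eTf); rewrite ujoins_sym.
Qed.

(* Each arc [f] is charged to its endpoint [far f] that is separated from the
   root [r] by [f]. *)
Lemma tree_card T : tree T -> vertex D -> #|T| <= #|vertex D| - 1.
Proof.
move=> tT r; case/andP: (tT) => _ acT.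
pose side f := ujoins (T :\ f) r (dtail f).
pose far f := if side f then dhead f else dtail f.
pose near f := if side f then dtail f else dhead f.
have farN f : f \in T -> ~~ ujoins (T :\ f) r (far f).
  move=> fT; rewrite /far; case: ifP => [rt|/negbT//].
  apply: contra (acyclic_arc acT fT); apply: joins_trans.
  by rewrite ujoins_sym.
have nearJ f : f \in T -> ujoins (T :\ f) r (near f).
  move=> fT; rewrite /near; case: ifP => // rt.
  have := tree_ujoins r (dtail f) tT; rewrite -{1}(setD1K fT).
  by case/ujoins_setU1=> [rt'|[rt' _]|[]//]; rewrite /side rt' in rt.
have near_far f X : f \in X -> ujoins X (near f) (far f).
  move=> fX; rewrite /near /far; case: ifP => _; last rewrite ujoins_sym.
    exact: ujoins_arc.
  exact: ujoins_arc.
have far_inj : {in T &, injective far}.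
  move=> f g fT gT fg; apply/eqP; apply: contraT => neq_fg.
  have fTg : f \in T :\ g by rewrite !inE neq_fg.
  have gTf : g \in T :\ f by rewrite !inE eq_sym neq_fg.
  have sf : subrel (ujoins (T :\ g :\ f)) (ujoins (T :\ f)).
    exact/ujoinsS/setSD/subD1set.
  have sg : subrel (ujoins (T :\ g :\ f)) (ujoins (T :\ g)).
    exact/ujoinsS/subD1set.
  (* The connection from [r] to [near g] avoiding [g] is split at [f]. As the far ends agree, the
     first two cases reach that end from [r] without [f], the third without [g]. *)
  have [rn|rf|fn] : [\/ ujoins (T :\ g :\ f) r (near g),
      ujoins (T :\ g :\ f) r (far f) | ujoins (T :\ g :\ f) (far f) (near g)].
  - have := nearJ g gT; rewrite -{1}(setD1K fTg) /far.
    case/ujoins_setU1=> [|[rt hn]|[rh tn]]; first by constructor 1.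
      by case: ifP; [constructor 3 | constructor 2].
    by case: ifP; [constructor 2 | constructor 3].
  - case/negP: (farN f fT); rewrite fg; apply: joins_trans (near_far g _ gTf).
    exact: sf.
  - by case/negP: (farN f fT); apply: sf.
  - case/negP: (farN g gT); apply: joins_trans (nearJ g gT) _.
    by rewrite ujoins_sym -fg; apply: sg.
rewrite -(card_in_imset far_inj) subn1 -(cardsC1 r); apply: subset_leq_card.
apply/subsetP=> _ /imsetP[f fT ->]; rewrite !inE.
by apply: contraNneq (farN f fT) => ->; apply: joins_refl.
Qed.

(** * Sequences of exchanges *)

Definition exchange s t B : rel {set darc D} := fun T T' =>
  [&& embracing s t T', #|symdiff T T'| == 2 & #|T :&: B| <= #|T' :&: B|].

(** The gain of [b] in the intersection with [B] makes up for the loss of [f], if any. *)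
Lemma exchangeI s t B T b f : b \in B -> b \notin T -> f \in T ->
  embracing s t (b |: T :\ f) -> exchange s t B T (b |: T :\ f).
Proof.
move=> bB bT fT emT'; rewrite /exchange emT' /=.
have bf : b != f by apply: contraNneq bT => ->.
apply/andP; split.
  rewrite (_ : symdiff _ _ = [set b; f]) ?cards2 ?bf //.
  apply/setP=> g; rewrite !inE.
  have [->|gb] := eqVneq g b; first by rewrite (negPf bT) (negPf bf).
  by have [->|gf] := eqVneq g f; [rewrite fT | case: (g \in T)].
apply: leq_trans (_ : #|b |: (T :&: B) :\ f| <= _); last first.
  apply: subset_leq_card; apply/subsetP=> g; rewrite !inE.
  by case/orP=> [/eqP->|/and3P[-> -> ->]]; rewrite ?eqxx ?orbT ?bB.
rewrite cardsU1 !inE (negPf bT) /= andbF (cardsD1 f (T :&: B)) leq_add2r.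
exact: leq_b1.
Qed.

(** Here [W] stands for the arcs that follow [b] on [B[s,t]], already present in [T]. *)
Lemma add_path_arc s t T W b :
    embracing s t T -> W \subset T -> djoins W (dhead b) t ->
    dhead b != dtail b ->
    {in W, forall f, (dtail f != dtail b) && (dhead f != dtail b)} ->
  exists2 f, f \in T :\: W & embracing s t (b |: T :\ f).
Proof.
move=> /andP[tT Tst] sWT Wbt bl Wb; case/andP: (tT) => _ acT.
(* The tail of [b] is isolated in [X], so a separating arc outside [X] is incident to it: this is
   the first arc of the tree path between the ends of [b]. *)
pose X := [set f in T | (dtail f != dtail b) && (dhead f != dtail b)].
have sWX : W \subset X.
  by apply/subsetP=> f fW; rewrite inE (subsetP sWT) // Wb.
have sXT : X \subset T by apply/subsetP=> f /[!inE] /andP[].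
have Xb : ~~ ujoins X (dtail b) (dhead b).
  apply/negP=> /connectP[[|w p] /=]; first by move=> _ hb; rewrite hb eqxx in bl.
  case/andP=> /adjP[x [xX _ su _]] _ _; move: xX; rewrite inE -su /step_src.
  by case: ifP => _; rewrite eqxx ?andbF.
have [f fTX sep] := separating_arc acT sXT (tree_ujoins _ _ tT) Xb.
have [fT fX] := setDP fTX.
have sWf : W \subset T :\ f.
  by rewrite subsetD1 sWT; apply: contra fX => /(subsetP sWX).
exists f; first by rewrite inE fT andbT; apply: contra fX => /(subsetP sWX).
rewrite /embracing tree_exchange //=.
have sT' : subrel (djoins (T :\ f)) (djoins (b |: T :\ f)).
  exact/djoinsS/subsetUr.
move: Tst; rewrite -{1}(setD1K fT) => /djoins_setU1[/sT'//|[sf ft]].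
have bt := djoinsS sWf Wbt.
have [tfb|tfb] := eqVneq (dtail f) (dtail b).
  rewrite tfb in sf; apply: joins_trans (sT' _ _ sf) _.
  by apply: joins_trans (djoins_arc (setU11 _ _)) _; apply: sT'.
(* If [f] enters the tail of [b], both ends of [b] reach [t] without [f], which contradicts
   [sep]. *)
have hfb : dhead f = dtail b.
  by apply/eqP; apply: contraNT fX => hfb; rewrite inE fT tfb.
case/negP: sep; rewrite -hfb; apply: joins_trans (djoins_ujoins ft) _.
by rewrite ujoins_sym; apply: djoins_ujoins.
Qed.

Lemma walk_src u v p x : is_walk u v p -> x \in p ->
  step_src x \in u :: [seq step_tgt y | y <- p].
Proof.
elim: p u => [|y p IHp] u //= /andP[/eqP su wp]; rewrite inE => /predU1P[->|xp].
  by rewrite su mem_head.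
by rewrite inE (IHp _ wp xp) orbT.
Qed.

(** The path [p] is a final segment of [B[s,t]], whence the general starting vertex [u]. The
    induction inserts the arcs after the first one before it, so the work proceeds backwards from
    [t]. *)
Lemma exchange_to_path s t A B u p :
    embracing s t A -> is_path B u t p -> directed p ->
  exists q, [/\ path (exchange s t B) A q, size q <= size p,
                embracing s t (last A q) & uses_only (last A q) p].
Proof.
move=> emA; elim: p u => [|x p IHp] u; first by exists [::].
case/and3P=> /= /andP[/eqP su wp] /andP[xB pB] /andP[ux Ux] /andP[dx dp].
have pP : is_path B (step_tgt x) t p by apply/and3P.
have [q [Aq szq emT pT]] := IHp _ pP dp.
have [xT|xT] := boolP (x.1 \in last A q); first by exists q; rewrite xT; split=> //; apply: leqW.
pose W := [set e in [seq y.1 | y <- p]].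
have sWT : W \subset last A q.
  by apply/subsetP=> e /[!inE] /mapP[y yp ->]; apply: (allP pT).
have Wxt : djoins W (dhead x.1) t.
  move: wp; rewrite {1}/step_tgt dx => wp; apply: is_path_joins wp _ dp.
  by apply/allP=> y yp; rewrite inE map_f.
move: (ux); rewrite inE negb_or -{1}su /step_src /step_tgt dx => /andP[xl _].
(* A path does not return to its first vertex [u], the tail of [x.1]. *)
have Wx : {in W, forall f, (dtail f != dtail x.1) && (dhead f != dtail x.1)}.
  move=> f /[!inE] /mapP[y yp ->].
  have xu : dtail x.1 = u by rewrite -su /step_src dx.
  have dy : y.2 by apply: (allP dp).
  have := walk_src wp yp; rewrite /step_src dy xu => ty.
  have hy : dhead y.1 \in [seq step_tgt z | z <- p].
    by apply/mapP; exists y; rewrite // /step_tgt dy.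
  by apply/andP; split; apply: contraNneq ux => <-; rewrite // inE hy orbT.
have [|f /setDP[fT fW] emT'] := add_path_arc emT sWT Wxt _ Wx; first by rewrite eq_sym.
exists (rcons q (x.1 |: last A q :\ f)); rewrite rcons_path last_rcons size_rcons.
split=> //; first by rewrite Aq exchangeI.
rewrite setU11 /=; apply/allP=> y yp; rewrite !inE (allP pT) // andbT.
by apply/orP; right; apply: contraNneq fW => <-; rewrite inE map_f.
Qed.

(** Only arcs outside [B] are removed, so [W] survives and keeps every tree embracing, while
    [B :\: A] shrinks at each exchange. *)
Lemma exchange_to_tree s t A B W : embracing s t A -> tree B ->
    W \subset A :&: B -> djoins W s t ->
  exists q, [/\ path (exchange s t B) A q, size q <= #|B :\: A| & last A q = B].
Proof.
move=> emA tB + Wst; case/andP: (tB) => _ acB.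
elim: {A}_.+1 {-2}A (ltnSn #|B :\: A|) emA => // n IHn A; rewrite ltnS => leBA emA.
rewrite subsetI => /andP[sWA sWB]; case/andP: (emA) => tA _; case/andP: (tA) => _ acA.
have [/eqP|[b]] := set_0Vmem (B :\: A).
  by rewrite setD_eq0 => /(tree_subset_eq tA tB) ->; exists [::].
case/setDP=> bB bA.
(* Applied to [A :&: B], [separating_arc] then gives an arc of [A] outside [B] on the cycle closed
   by [b]. *)
have sep : ~~ ujoins (A :&: B) (dtail b) (dhead b).
  apply: contra (acyclic_arc acB bB); apply: ujoinsS.
  by rewrite subsetD1 subsetIr inE (negPf bA).
have [f] := separating_arc acA (subsetIl A B) (tree_ujoins _ _ tA) sep.
rewrite !inE => /andP[+ fA]; rewrite fA /= => fB Af.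
have sWf : W \subset A :\ f.
  by rewrite subsetD1 sWA; apply: contra fB => /(subsetP sWB).
have emA' : embracing s t (b |: A :\ f).
  rewrite /embracing tree_exchange //=; apply: djoinsS Wst.
  exact: subset_trans sWf (subsetUr _ _).
have BA' : #|B :\: (b |: A :\ f)| < #|B :\: A|.
  apply: proper_card; apply/properP; split; last first.
    by exists b; rewrite !inE ?eqxx ?bB ?bA.
  apply/subsetP=> g; rewrite !inE negb_or => /andP[/andP[_ +] gB].
  by rewrite gB negb_and negbK => /orP[/eqP gf|->//]; rewrite -gf gB in fB.
have [|q [A'q szq lq]] := IHn _ (leq_trans BA' leBA) emA'.
  by rewrite subsetI sWB (subset_trans sWf (subsetUr _ _)).
by exists ((b |: A :\ f) :: q); rewrite /= exchangeI // lq; split=> //; apply: leq_ltn_trans BA'.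
Qed.

End Digraph.

Theorem theorem2p1 (D : digraph) (s t : vertex D) (A B : {set darc D}) :
  embracing_tree s t A ->
  embracing_tree s t B ->
  exists (q : nat) (T : nat -> {set darc D}),
    [/\ q <= #|vertex D| - 1,
        T 0 = A,
        T q = B,
        forall i : nat, i <= q -> embracing_tree s t (T i)
      & forall i : nat, 1 <= i <= q ->
          #|symdiff (T i.-1) (T i)| = 2 /\
          #|T i.-1 :&: B| <= #|T i :&: B|].
Proof.
move=> /embracingP emA [/treeP tB [p [pP dp]]].
have [q1 [Aq1 szq1 emT pT]] := exchange_to_path emA pP dp.
have Up := is_path_uniq_arcs pP; case/and3P: pP => wp pB _.
pose W := [set e in [seq x.1 | x <- p]].
have sWT : W \subset last A q1.
  by apply/subsetP=> e /[!inE] /mapP[x xp ->]; apply: (allP pT).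
have sWB : W \subset B.
  by apply/subsetP=> e /[!inE] /mapP[x xp ->]; apply: (allP pB).
have cW : #|W| = size p by rewrite cardsE (card_uniqP Up) size_map.
have Wst : joins (fun x => x.2) W s t.
  by apply: is_path_joins wp _ dp; apply/allP=> x xp; rewrite inE map_f.
have [|q2 [Tq2 szq2 lq2]] := exchange_to_tree emT tB _ Wst.
  by rewrite subsetI sWT.
have exq : path (exchange s t B) A (q1 ++ q2) by rewrite cat_path Aq1.
exists (size (q1 ++ q2)), (nth B (A :: q1 ++ q2)); split=> //.
(* The first phase costs at most the size of [W], the second at most that of [B :\: W]; together
   this is the number of arcs of [B]. *)
- apply: leq_trans (tree_card tB s); rewrite size_cat.
  apply: leq_trans (leq_add szq1 szq2) _.
  rewrite -cW -(cardsID W B) (setIidPr sWB) leq_add2l.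
  exact/subset_leq_card/setDS.
- by rewrite -last_nth last_cat.
(* Entry 0 is [A] itself; every later entry is the target of an [exchange], which includes being
   embracing. *)
- case=> [|i] lti; apply/embracingP => //.
  by case/and3P: (pathP B exq i lti).
case=> // i /andP[_ lti].
by case/and3P: (pathP B exq i lti) => _ /eqP.
Qed.
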